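(* Let $\Phi$ be an irreducible reduced root system. A triple $(\lambda,\mu,\nu)$ of dominant weights is a low triple if and only if $\lambda$ and $\mu$ are minuscule weights, $\mu=-w_0\lambda$, and $\nu=0$.
   Context: $\Phi$ has basis $\Delta=\{\alpha_1,\dots,\alpha_\ell\}$, weight lattice $\Lambda$, dominant weights $\Lambda^+$, Weyl group $W$ with longest element $w_0$. The dominant order on $\Lambda$: $\mu\le\lambda$ iff $\lambda-\mu$ is a nonnegative integer combination of simple roots. A triple $(\lambda,\mu,\nu)$ of dominant weights is a low triple if (i) whenever $\lambda',\mu'\in\Lambda^+$ satisfy $\lambda'\le\lambda$, $\mu'\le\mu$ and $\nu\le\lambda'+\mu'$, then $\lambda'=\lambda$ and $\mu'=\mu$; and (ii) $\nu+\sum_{i=1}^\ell\alpha_i\le\lambda+\mu$. A dominant weight is minuscule if it is nonzero and its Weyl group orbit is the set of all weights of the corresponding irreducible representation (equivalently, it is minimal among nonzero dominant weights in its class modulo the root lattice with respect to $\le$). *)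

(* Defs.v *)
From HB Require Import structures.
From mathcomp Require Import all_boot all_order all_algebra.
From mathcomp Require Import reals.
Set Implicit Arguments. Unset Strict Implicit. Unset Printing Implicit Defensive.
Import Order.TTheory GRing.Theory Num.Theory.
Local Open Scope ring_scope.

Section RootSystems.
Variables (R : realType) (n : nat).
Notation V := 'rV[R]_n.

Definition dot (u v : V) : R := (u *m v^T) 0 0.

Definition cpair (b a : V) : R := 2 * dot b a / dot a a.

Definition refl (a v : V) : V := v - cpair v a *: a.

Definition is_intR (x : R) : Prop := exists z : int, x = z%:~R.

Definition root_system (Phi : seq V) : Prop :=
  [/\ (0 : V) \notin Phi,
      (forall v : V, exists c : 'I_(size Phi) -> R,
          v = \sum_(i < size Phi) c i *: Phi`_i),
      (forall a b, a \in Phi -> b \in Phi -> refl a b \in Phi) &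
      (forall a b, a \in Phi -> b \in Phi -> is_intR (cpair b a))].

Definition reduced (Phi : seq V) : Prop :=
  forall (a : V) (c : R), a \in Phi -> c *: a \in Phi -> c = 1 \/ c = -1.

Definition irreducible (Phi : seq V) : Prop :=
  Phi <> [::] /\
  forall P : V -> bool,
    (forall a b, a \in Phi -> b \in Phi -> P a -> ~~ P b -> dot a b = 0) ->
    (forall a, a \in Phi -> P a) \/ (forall a, a \in Phi -> ~~ P a).

Definition is_base (Phi : seq V) (l : nat) (alpha : 'I_l -> V) : Prop :=
  [/\ (forall i, alpha i \in Phi),
      (forall c : 'I_l -> R, \sum_i c i *: alpha i = 0 -> forall i, c i = 0) &
      (forall b, b \in Phi -> exists k : 'I_l -> int,
          b = \sum_i (k i)%:~R *: alpha i /\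
          ((forall i, 0 <= k i) \/ (forall i, k i <= 0)))].

Definition is_weight (Phi : seq V) (v : V) : Prop :=
  forall a, a \in Phi -> is_intR (cpair v a).

Definition dominant (Phi : seq V) (l : nat) (alpha : 'I_l -> V) (v : V) : Prop :=
  is_weight Phi v /\ forall i, 0 <= cpair v (alpha i).

Definition dom_le (l : nat) (alpha : 'I_l -> V) (mu lam : V) : Prop :=
  exists k : 'I_l -> nat, lam - mu = \sum_i (k i)%:R *: alpha i.

Definition low_triple (Phi : seq V) (l : nat) (alpha : 'I_l -> V)
    (lam mu nu : V) : Prop :=
  (forall lam' mu', dominant Phi alpha lam' -> dominant Phi alpha mu' ->
     dom_le alpha lam' lam -> dom_le alpha mu' mu -> dom_le alpha nu (lam' + mu') ->
     lam' = lam /\ mu' = mu)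
  /\ dom_le alpha (nu + \sum_i alpha i) (lam + mu).

Definition minuscule (Phi : seq V) (l : nat) (alpha : 'I_l -> V) (lam : V) : Prop :=
  [/\ lam <> 0, dominant Phi alpha lam &
      forall mu, dominant Phi alpha mu -> dom_le alpha mu lam -> mu = lam].

(* Weyl group W = < s_1, ..., s_l >; elements represented by words *)
Definition wact (l : nat) (alpha : 'I_l -> V) (s : seq 'I_l) (v : V) : V :=
  foldr (fun i w => refl (alpha i) w) v s.

Definition same_elt (l : nat) (alpha : 'I_l -> V) (s t : seq 'I_l) : Prop :=
  forall v, wact alpha s v = wact alpha t v.

(* s is a reduced word for a longest element w_0 of W *)
Definition longest_word (l : nat) (alpha : 'I_l -> V) (s : seq 'I_l) : Prop :=
  (forall t, same_elt alpha t s -> (size s <= size t)%N) /\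
  (forall t, exists t', same_elt alpha t' t /\ (size t' <= size s)%N).

End RootSystems.

(* Main.v *)
Require Import Defs.
From HB Require Import structures.
From mathcomp Require Import all_boot all_order all_algebra.
From mathcomp Require Import reals boolp ring lra zify.
Set Implicit Arguments. Unset Strict Implicit. Unset Printing Implicit Defensive.
Import Order.TTheory GRing.Theory Num.Theory.
Local Open Scope ring_scope.

(* Let Pi(lam) be the set of vectors all of whose Weyl conjugates are <= lam.
   Since Pi(lam) + Pi(mu) is stable under subtracting simple roots that pair
   positively, every dominant nu <= lam + mu is a sum x + y with x in Pi(lam),
   y in Pi(mu). The first clause of a low triple forces x in W lam, y in W mu
   for every such decomposition. Transferring simple roots from y to x until x
   is dominant gives the decomposition nu = lam + (nu - lam); transferring them
   back until y is dominant gives nu = (nu - mu) + mu. In the second process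
   both summands keep their norms, which is possible only for simple roots
   orthogonal to nu; so lam + mu - nu is supported on those simple roots, and
   the second clause gives nu = 0 and mu in W(- lam), i.e. mu = - w0 lam.
   Minimality of lam and mu then follows because a dominant element of the root
   lattice is >= 0. Conversely lam - w0 lam is a nonzero dominant element of the
   root lattice, hence has full support when Phi is irreducible. *)

(** * Scalar product, coroot pairing and reflections *)

Section Euclidean.
Variables (R : realType) (n : nat).
Notation V := 'rV[R]_n.
Implicit Types (u v w a b : V) (c : R).

Lemma dotE u v : dot u v = \sum_j u 0 j * v 0 j.
Proof. by rewrite /dot mxE; apply: eq_bigr => j _; rewrite mxE. Qed.

Lemma dotC u v : dot u v = dot v u.
Proof. by rewrite !dotE; apply: eq_bigr => j _; rewrite mulrC. Qed.

Lemma dotDl u v w : dot (u + v) w = dot u w + dot v w.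
Proof. by rewrite /dot mulmxDl mxE. Qed.

Lemma dotZl c u v : dot (c *: u) v = c * dot u v.
Proof. by rewrite /dot -scalemxAl mxE. Qed.

Lemma dotNl u v : dot (- u) v = - dot u v.
Proof. by rewrite -scaleN1r dotZl mulN1r. Qed.

Lemma dotBl u v w : dot (u - v) w = dot u w - dot v w.
Proof. by rewrite dotDl dotNl. Qed.

Lemma dot0l v : dot 0 v = 0.
Proof. by rewrite -(scale0r (0 : V)) dotZl mul0r. Qed.

Lemma dotDr u v w : dot u (v + w) = dot u v + dot u w.
Proof. by rewrite dotC dotDl !(dotC u). Qed.

Lemma dotZr c u v : dot u (c *: v) = c * dot u v.
Proof. by rewrite dotC dotZl dotC. Qed.

Lemma dotNr u v : dot u (- v) = - dot u v.
Proof. by rewrite dotC dotNl dotC. Qed.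

Lemma dotBr u v w : dot u (v - w) = dot u v - dot u w.
Proof. by rewrite dotDr dotNr. Qed.

Lemma dot_suml I (r : seq I) (P : pred I) (F : I -> V) v :
  dot (\sum_(i <- r | P i) F i) v = \sum_(i <- r | P i) dot (F i) v.
Proof.
by apply: (big_morph (fun u => dot u v)) => [u w|]; rewrite ?dotDl ?dot0l.
Qed.

Lemma dot_ge0 v : 0 <= dot v v.
Proof. by rewrite dotE sumr_ge0 // => j _; rewrite -expr2 sqr_ge0. Qed.

Lemma dot_eq0 v : dot v v = 0 -> v = 0.
Proof.
rewrite dotE => /eqP; rewrite psumr_eq0 => [/allP v0|j _]; last first.
  by rewrite -expr2 sqr_ge0.
apply/rowP=> j; rewrite mxE.
by have := v0 j (mem_index_enum j); rewrite mulf_eq0 orbb => /eqP.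
Qed.

Lemma dot_gt0 v : v <> 0 -> 0 < dot v v.
Proof.
move=> v0; rewrite lt_neqAle dot_ge0 andbT eq_sym.
by apply/eqP => /dot_eq0.
Qed.

Lemma cpairDl u v a : cpair (u + v) a = cpair u a + cpair v a.
Proof. by rewrite /cpair dotDl mulrDr mulrDl. Qed.

Lemma cpairZl c u a : cpair (c *: u) a = c * cpair u a.
Proof. by rewrite /cpair dotZl mulrCA -!mulrA. Qed.

Lemma cpairNl u a : cpair (- u) a = - cpair u a.
Proof. by rewrite -scaleN1r cpairZl mulN1r. Qed.

Lemma cpairBl u v a : cpair (u - v) a = cpair u a - cpair v a.
Proof. by rewrite cpairDl cpairNl. Qed.

Lemma cpair_dot u a : a <> 0 -> cpair u a * dot a a = 2 * dot u a.
Proof. by move=> /dot_gt0 a0; rewrite /cpair divfK // gt_eqF. Qed.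

Lemma cpair_self a : a <> 0 -> cpair a a = 2.
Proof. by move=> /dot_gt0 a0; rewrite /cpair mulfK // gt_eqF. Qed.

Lemma cpair_ge0 u a : a <> 0 -> (0 <= cpair u a) = (0 <= dot u a).
Proof.
move=> /dot_gt0 a0; rewrite /cpair -mulrA pmulr_rge0 ?ltr0n //.
by rewrite pmulr_lge0 // invr_gt0.
Qed.

Lemma cpair_gt0 u a : a <> 0 -> (0 < cpair u a) = (0 < dot u a).
Proof.
move=> /dot_gt0 a0; rewrite /cpair -mulrA pmulr_rgt0 ?ltr0n //.
by rewrite pmulr_lgt0 // invr_gt0.
Qed.

Lemma cpair_eq0 u a : a <> 0 -> cpair u a = 0 -> dot u a = 0.
Proof.
move=> a0 c0; have := cpair_dot u a0; rewrite c0 mul0r => /esym/eqP.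
by rewrite mulf_eq0 pnatr_eq0 /= => /eqP.
Qed.

Lemma reflD a u v : refl a (u + v) = refl a u + refl a v.
Proof. by rewrite /refl cpairDl; apply/rowP=> j; rewrite !mxE; ring. Qed.

Lemma reflZ a c u : refl a (c *: u) = c *: refl a u.
Proof. by rewrite /refl cpairZl; apply/rowP=> j; rewrite !mxE; ring. Qed.

Lemma refl_self a : a <> 0 -> refl a a = - a.
Proof.
by move=> a0; rewrite /refl cpair_self //; apply/rowP=> j; rewrite !mxE; ring.
Qed.

Lemma reflK a : a <> 0 -> involutive (refl a).
Proof.
move=> a0 u; rewrite {1}/refl {2}/refl cpairBl cpairZl cpair_self // /refl.
by apply/rowP=> j; rewrite !mxE; ring.
Qed.

Lemma dot_refl a u v : a <> 0 -> dot (refl a u) (refl a v) = dot u v.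
Proof.
move=> a0; rewrite /refl dotBl !dotBr !dotZl !dotZr.
have := cpair_dot u a0; have := cpair_dot v a0.
move: (cpair u a) (cpair v a) => x y Hv Hu.
rewrite (dotC a v); move: (dot u v) (dot a a) (dot v a) (dot u a) Hu Hv.
move=> p q r s Hu Hv.
have E : 2 * (x * r) = 2 * (y * s) by rewrite mulrCA -Hv (mulrCA 2) -Hu; ring.
by rewrite Hv; lra.
Qed.

Lemma cpair_eq1 u a : a <> 0 -> dot (u - a) (u - a) = dot u u -> cpair u a = 1.
Proof.
move=> a0; rewrite dotBl !dotBr (dotC a u) => E.
apply: (mulIf (lt0r_neq0 (dot_gt0 a0))); rewrite cpair_dot // mul1r.
by move: E; lra.
Qed.

End Euclidean.

(** * Combinations of simple roots and their natural-number cone *)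

Section RootSystem.
Variables (R : realType) (n l : nat) (Phi : seq 'rV[R]_n).
Variable alpha : 'I_l -> 'rV[R]_n.
Notation V := 'rV[R]_n.
Hypothesis rootPhi : root_system Phi.
Hypothesis redPhi : reduced Phi.
Hypothesis basePhi : is_base Phi alpha.
Implicit Types (u v w a b x y lam : V) (i j : 'I_l) (s t : seq 'I_l).

Definition comb (c : 'I_l -> R) : V := \sum_i c i *: alpha i.

(** By conversion, [dom_le alpha u v] is [cone (v - u)]. *)
Definition cone v := exists k : 'I_l -> nat, v = comb (fun i => (k i)%:R).

Lemma combD c d : comb c + comb d = comb (fun i => c i + d i).
Proof. by rewrite /comb -big_split; apply: eq_bigr => i _; rewrite scalerDl. Qed.

Lemma combZ z c : z *: comb c = comb (fun i => z * c i).
Proof. by rewrite /comb scaler_sumr; apply: eq_bigr => i _; rewrite scalerA. Qed.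

Lemma combN c : - comb c = comb (fun i => - c i).
Proof. by rewrite /comb -sumrN; apply: eq_bigr => i _; rewrite scaleNr. Qed.

Lemma combB c d : comb c - comb d = comb (fun i => c i - d i).
Proof. by rewrite combN combD. Qed.

Lemma eq_comb c d : c =1 d -> comb c = comb d.
Proof. by move=> E; apply: eq_bigr => i _; rewrite E. Qed.

Lemma comb_delta i : alpha i = comb (fun j => (j == i)%:R).
Proof.
rewrite /comb (bigD1 i) //= eqxx scale1r big1 ?addr0 // => j /negbTE->.
by rewrite scale0r.
Qed.

Lemma comb_inj c d : comb c = comb d -> c =1 d.
Proof.
move=> E i; have [_ free _] := basePhi.
have := free (fun i => c i - d i); rewrite -/(comb _) -combB E subrr.
by move=> /(_ erefl i)/eqP; rewrite subr_eq0 => /eqP.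
Qed.

Lemma dot_comb c v : dot (comb c) v = \sum_i c i * dot (alpha i) v.
Proof. by rewrite dot_suml; apply: eq_bigr => i _; rewrite dotZl. Qed.

Lemma alpha_root i : alpha i \in Phi.
Proof. by have [] := basePhi. Qed.

Lemma root_neq0 a : a \in Phi -> a <> 0.
Proof. by have [Phi0 _ _ _] := rootPhi => + E; rewrite E (negbTE Phi0). Qed.

Lemma alpha_neq0 i : alpha i <> 0.
Proof. exact/root_neq0/alpha_root. Qed.
Hint Resolve alpha_root alpha_neq0 : core.

Lemma refl_root a b : a \in Phi -> b \in Phi -> refl a b \in Phi.
Proof. by have [_ _ + _] := rootPhi; apply. Qed.

Lemma oppr_root a : a \in Phi -> - a \in Phi.
Proof. by move=> aP; rewrite -refl_self ?refl_root //; apply: root_neq0. Qed.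

Lemma root_coneVN a : a \in Phi -> cone a \/ cone (- a).
Proof.
have [_ _ int /int[k [-> [k0|k0]]]] := basePhi.
  left; exists (fun i => `|k i|%N); apply: eq_comb => i.
  by rewrite natr_absz ger0_norm.
right; exists (fun i => `|k i|%N); rewrite -/(comb _) combN; apply: eq_comb => i.
by rewrite natr_absz ler0_norm // mulrNz.
Qed.

Lemma cone_alpha i : cone (alpha i).
Proof. by exists (fun j => (j == i) : nat); rewrite comb_delta. Qed.

Lemma cone0 : cone 0.
Proof.
by exists (fun=> 0%N); rewrite /comb big1 // => i _; rewrite scale0r.
Qed.

Lemma coneD u v : cone u -> cone v -> cone (u + v).
Proof.
move=> [k ->] [k' ->]; exists (fun i => k i + k' i)%N.
by rewrite combD; apply: eq_comb => i; rewrite natrD.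
Qed.

Lemma coneZ (m : nat) v : cone v -> cone (m%:R *: v).
Proof.
move=> [k ->]; exists (fun i => m * k i)%N.
by rewrite combZ; apply: eq_comb => i; rewrite natrM.
Qed.

Lemma cone_anti v : cone v -> cone (- v) -> v = 0.
Proof.
move=> [k ->] [k' E]; rewrite /comb big1 // => i _.
have := comb_inj (etrans (esym (combN _)) E) i => /eqP.
rewrite eqr_oppLR -subr_eq0 opprK -natrD pnatr_eq0 addn_eq0 => /andP[/eqP-> _].
by rewrite scale0r.
Qed.

(** * Positivity of combinations of simple roots *)

Lemma dot_alpha_eq0 v : (forall i, dot v (alpha i) = 0) -> v = 0.
Proof.
move=> v0; apply: dot_eq0.
have [_ span _ _] := rootPhi; have [c {1}->] := span v.
rewrite dot_suml big1 // => k _; rewrite dotZl.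
have [_ _ /(_ Phi`_k)] := basePhi; rewrite mem_nth // => /(_ isT)[d [-> _]].
by rewrite -/(comb _) dot_comb big1 ?mulr0 // => i _; rewrite dotC v0 mulr0.
Qed.

(** The positive squared norm is the sum of the products of [k i] with the pairing against
    [alpha i], so some product is positive. This supplies the simple root for the descents in
    [supported_root] and [saturation_split]. *)
Lemma comb_pos_dot (k : 'I_l -> nat) : comb (fun i => (k i)%:R) <> 0 ->
  exists i, (0 < k i)%N /\ 0 < dot (comb (fun i => (k i)%:R)) (alpha i).
Proof.
set v := comb _ => v0; have := dot_gt0 v0; rewrite {1}/v dot_comb => pos.
apply: contrapT => /forallNP no.
move: pos; rewrite ltNge sumr_le0 // => i _.
have [->|ki] := posnP (k i); first by rewrite mul0r.
rewrite mulr_ge0_le0 // dotC leNgt; apply/negP => pi.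
by apply: (no i).
Qed.

(** A positive pairing would make [refl (alpha j) (alpha i)] a root with coefficient 1 at [i] and a
    negative one at [j]. *)
Lemma alpha_obtuse i j : i != j -> dot (alpha i) (alpha j) <= 0.
Proof.
move=> ij; rewrite leNgt -cpair_gt0 //; apply/negP => cp.
have := root_coneVN (refl_root (alpha_root j) (alpha_root i)).
rewrite /refl; move: (cpair _ _) cp => c cp.
rewrite {1 2}(comb_delta i) (comb_delta j) combZ combB.
case=> [[k]|[k]]; rewrite ?combN => /comb_inj E.
  have := E j; rewrite eqxx eq_sym (negbTE ij) mulr1 sub0r => Ej.
  by have := ler0n R (k j); rewrite -Ej oppr_ge0 leNgt cp.
have := E i; rewrite eqxx (negbTE ij) mulr0 subr0 => Ei.
by have := ler0n R (k i); rewrite -Ei oppr_ge0 leNgt ltr01.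
Qed.

(** Split the vector as [comb p - comb m] into positive and negative parts. It pairs nonnegatively
    with [comb m], while [comb p] pairs nonpositively with [comb m], the supports being disjoint and
    simple roots obtuse. Hence [comb m] has norm zero. *)
Lemma comb_ge0 c : (forall i, 0 <= dot (comb c) (alpha i)) ->
  forall i, 0 <= c i.
Proof.
move=> dom i.
pose p i := Num.max (c i) 0; pose m i := Num.max (- c i) 0.
have p0 k : 0 <= p k by rewrite le_max lexx orbT.
have m0 k : 0 <= m k by rewrite le_max lexx orbT.
have pm k : p k * m k = 0.
  rewrite /p /m; have [ck|ck] := leP 0 (c k).
    by rewrite (max_r (y := 0)) ?mulr0 // oppr_le0.
  by rewrite mul0r.
have cE : comb p - comb m = comb c.
  rewrite combB; apply: eq_comb => k; rewrite /p /m.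
  have [ck|ck] := leP 0 (c k).
    by rewrite (max_r (y := 0)) ?subr0 // oppr_le0.
  by rewrite max_l ?sub0r ?opprK // oppr_ge0 ltW.
have vm : 0 <= dot (comb c) (comb m).
  rewrite dotC dot_comb sumr_ge0 // => k _.
  by rewrite mulr_ge0 // dotC.
have pm0 : dot (comb p) (comb m) <= 0.
  rewrite dot_comb sumr_le0 // => k _; rewrite dotC dot_comb mulr_sumr.
  rewrite sumr_le0 // => k' _; have [->|kk] := eqVneq k' k.
    by rewrite mulrA pm mul0r.
  by rewrite mulrA mulr_ge0_le0 ?mulr_ge0 ?alpha_obtuse.
have mm : dot (comb m) (comb m) = 0.
  apply/eqP; rewrite eq_le dot_ge0 andbT.
  by move: vm; rewrite -cE dotBl; lra.
have /(comb_inj (d := fun=> 0))/(_ i) : comb m = comb (fun=> 0).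
  by rewrite (dot_eq0 mm) /comb big1 // => k _; rewrite scale0r.
by rewrite /m => mi; rewrite -oppr_le0 -mi le_max lexx.
Qed.

(** * Supports of roots and irreducibility *)

Definition supported (Z : pred 'I_l) v :=
  exists c, v = comb c /\ forall i, ~~ Z i -> c i = 0.

Lemma supportedD Z u v :
  supported Z u -> supported Z v -> supported Z (u + v).
Proof.
move=> [c [-> c0]] [d [-> d0]]; exists (fun i => c i + d i).
by rewrite combD; split=> // i Zi; rewrite c0 // d0 // addr0.
Qed.

Lemma supportedZ Z z v : supported Z v -> supported Z (z *: v).
Proof.
move=> [c [-> c0]]; exists (fun i => z * c i).
by rewrite combZ; split=> // i Zi; rewrite c0 // mulr0.
Qed.

Lemma supported_alpha (Z : pred 'I_l) i : Z i -> supported Z (alpha i).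
Proof.
move=> Zi; exists (fun j => (j == i)%:R); split; first exact: comb_delta.
by move=> j; case: eqP => // ->; rewrite Zi.
Qed.

Lemma supported_dot (Z Z' : pred 'I_l) u v :
  (forall i j, Z i -> Z' j -> dot (alpha i) (alpha j) = 0) ->
  supported Z u -> supported Z' v -> dot u v = 0.
Proof.
move=> orth [c [-> c0]] [d [-> d0]].
rewrite dot_comb big1 // => i _.
have [Zi|/c0->] := boolP (Z i); last by rewrite mul0r.
rewrite dotC dot_comb big1 ?mulr0 // => j _.
have [Zj|/d0->] := boolP (Z' j); last by rewrite mul0r.
by rewrite dotC orth ?mulr0.
Qed.

Lemma cpair_int a b : a \in Phi -> b \in Phi -> is_intR (cpair b a).
Proof. by have [_ _ _ +] := rootPhi; apply. Qed.

Lemma int_gt0_nat (x : R) : is_intR x -> 0 < x -> exists m : nat, x = m.+1%:R.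
Proof.
move=> [z ->]; rewrite ltr0z; case: z => // -[//|m] _; by exists m.
Qed.

(** Descent on the height of a positive root [a]: reflect it in a simple root pairing positively
    with it. If the result [b] is positive, it lies on one side by induction, and [alpha i] lies on
    the same side because [dot b (alpha i)] is nonzero. *)
Lemma supported_root (Z : pred 'I_l) :
  (forall i j, Z i -> ~~ Z j -> dot (alpha i) (alpha j) = 0) ->
  forall a, a \in Phi -> supported Z a \/ supported (predC Z) a.
Proof.
move=> orth a aP.
wlog [k aE] : a aP / cone a.
  move=> pos; have [/pos|/(pos _ (oppr_root aP))] := root_coneVN aP; first exact.
  by rewrite -[X in _ -> supported Z X \/ supported _ X]opprK -!scaleN1r;
     case=> /supportedZ; auto.
have [m mE] : exists m, m = (\sum_i k i)%N by eexists.
elim/ltn_ind: m a aP k aE mE => m IH a aP k aE mE.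
have ZVC i : supported Z (alpha i) \/ supported (predC Z) (alpha i).
  by have [Zi|Zi] := boolP (Z i); [left|right]; apply: supported_alpha.
have [i [ki ai]] : exists i, (0 < k i)%N /\ 0 < dot a (alpha i).
  by rewrite aE; apply: comb_pos_dot; rewrite -aE; apply: root_neq0.
have [q qE] : exists q : nat, cpair a (alpha i) = q.+1%:R.
  by apply: int_gt0_nat; [apply: cpair_int | rewrite cpair_gt0].
pose b := refl (alpha i) a.
have bE : a = b + q.+1%:R *: alpha i by rewrite /b /refl qE subrK.
have bP : b \in Phi by apply: refl_root.
have bi : dot b (alpha i) <> 0.
  rewrite /b /refl dotBl dotZl cpair_dot // => E; move: ai.
  by rewrite (_ : dot a _ = 0) ?ltxx //; lra.
have [[k' k'E]|[k' k'E]] := root_coneVN bP.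
  have kE j : k j = (k' j + q.+1 * (j == i))%N.
    apply/eqP; rewrite -(eqr_nat R) natrD natrM.
    apply/eqP; move: j; apply: comb_inj.
    by rewrite -combD -combZ -comb_delta -k'E -aE.
  have lt : (\sum_j k' j < m)%N.
    rewrite mE (eq_bigr _ (fun j _ => kE j)) big_split /=.
    rewrite (bigD1 i (P := predT) (F := fun j => q.+1 * (j == i)))%N //= eqxx.
    by lia.
  have [bZ|bZ] := IH _ lt b bP k' k'E erefl;
      have [Zi|Zi] := boolP (Z i).
  - by left; rewrite bE; apply/supportedD/supportedZ/supported_alpha.
  - case: bi; apply: (supported_dot (Z' := predC Z)) bZ _ => //.
    exact: supported_alpha.
  - case: bi; rewrite dotC; apply: supported_dot (supported_alpha Zi) bZ => //.
  - by right; rewrite bE; apply/supportedD/supportedZ/supported_alpha.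
(* Here [b] is negative: [a] and [- b] have natural coefficients and add up to a multiple of
   [alpha i], so [a] is such a multiple too. *)
have k0 j : j != i -> k j = 0%N.
  move=> ji; have : comb (fun j => (k j + k' j)%:R) = q.+1%:R *: alpha i.
    rewrite (eq_comb (fun j => natrD _ _ _)) -combD -k'E -aE {1}bE.
    by rewrite addrAC subrr add0r.
  rewrite [in RHS]comb_delta combZ => /comb_inj/(_ j); rewrite (negbTE ji) mulr0.
  by move/eqP; rewrite pnatr_eq0 addn_eq0 => /andP[/eqP].
have -> : a = (k i)%:R *: alpha i.
  rewrite [LHS]aE /comb (bigD1 i) //= big1 ?addr0 // => j /k0->.
  by rewrite scale0r.
by have [Zi|Zi] := ZVC i; [left|right]; apply: supportedZ.
Qed.

(** Let [Z] be the set of indices with zero coefficient. For [j] in [Z] the pairing with [alpha j]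
    is nonnegative, yet a sum of nonpositive terms, so all terms vanish and [Z] is orthogonal to its
    complement. Irreducibility makes [Z] empty or full, and full would give the zero vector. *)
Lemma comb_gt0 c : irreducible Phi -> comb c <> 0 ->
  (forall i, 0 <= dot (comb c) (alpha i)) -> forall i, 0 < c i.
Proof.
move=> [_ irr] v0 dom i; have c0 := comb_ge0 dom.
rewrite lt_neqAle c0 andbT eq_sym; apply/negP => ci.
pose Z := [pred j | c j == 0].
have orth j j' : Z j -> ~~ Z j' -> dot (alpha j) (alpha j') = 0.
  move=> /eqP /= cj cj'; have := dom j; rewrite dot_comb => ge.
  have le k : c k * dot (alpha k) (alpha j) <= 0.
    have [->|kj] := eqVneq k j; first by rewrite cj mul0r.
    by rewrite mulr_ge0_le0 ?alpha_obtuse.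
  have : \sum_k - (c k * dot (alpha k) (alpha j)) == 0.
    rewrite eq_le sumrN oppr_le0 ge /= -sumrN sumr_ge0 // => k _.
    by rewrite oppr_ge0.
  rewrite psumr_eq0 => [/allP/(_ j' (mem_index_enum _))|k _]; last first.
    by rewrite oppr_ge0.
  by rewrite /= oppr_eq0 mulf_eq0 (negbTE cj') dotC => /eqP.
have [a b aP bP /asboolP Pa /asboolP nPb|allZ|noZ] :=
    irr (fun v => `[< supported Z v >]).
- have [//|] := supported_root orth bP.
  exact: supported_dot orth Pa.
- case: v0; rewrite /comb big1 // => j _.
  have /allZ/asboolP[d [+ d0]] := alpha_root j.
  rewrite comb_delta => /comb_inj/(_ j); rewrite eqxx.
  have [/eqP->|/d0->] := boolP (Z j); first by rewrite scale0r.
  by move/eqP; rewrite oner_eq0.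
- have /noZ/asboolP[] := alpha_root i.
  exact: supported_alpha.
Qed.

(** * Weyl group words and the exchange property *)

Notation wact := (wact alpha).
Notation is_weight := (is_weight Phi).
Notation dominant := (dominant Phi alpha).

Lemma wact_cat s t v : wact (s ++ t) v = wact s (wact t v).
Proof. by rewrite /Defs.wact foldr_cat. Qed.

Lemma wact_rcons s i v : wact (rcons s i) v = wact s (refl (alpha i) v).
Proof. by rewrite -cats1 wact_cat. Qed.

Lemma wactD s u v : wact s (u + v) = wact s u + wact s v.
Proof. by elim: s => //= i s ->; rewrite reflD. Qed.

Lemma wactZ s c v : wact s (c *: v) = c *: wact s v.
Proof. by elim: s => //= i s ->; rewrite reflZ. Qed.

Lemma wactN s v : wact s (- v) = - wact s v.
Proof. by rewrite -!scaleN1r wactZ. Qed.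

Lemma wactB s u v : wact s (u - v) = wact s u - wact s v.
Proof. by rewrite wactD wactN. Qed.

Lemma wactK s v : wact (rev s) (wact s v) = v.
Proof. by elim: s v => //= i s IH v; rewrite rev_cons wact_rcons reflK. Qed.

Lemma wactVK s v : wact s (wact (rev s) v) = v.
Proof. by rewrite -{1}[s]revK wactK. Qed.

Lemma dot_wact s u v : dot (wact s u) (wact s v) = dot u v.
Proof. by elim: s => //= i s <-; rewrite dot_refl. Qed.

Lemma cpair_wact s u v : cpair (wact s u) (wact s v) = cpair u v.
Proof. by rewrite /cpair !dot_wact. Qed.

Lemma wact_root s a : a \in Phi -> wact s a \in Phi.
Proof. by move=> aP; elim: s => //= i s IH; apply: refl_root. Qed.

Lemma wact_comb s c : wact s (comb c) = \sum_i c i *: wact s (alpha i).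
Proof.
have wact0 : wact s 0 = 0 by rewrite -(scale0r (0 : V)) wactZ !scale0r.
rewrite /comb (big_morph (wact s) (wactD s) wact0).
by apply: eq_bigr => i _; rewrite wactZ.
Qed.

Lemma wact_refl s i v :
  wact s (refl (alpha i) v) = refl (wact s (alpha i)) (wact s v).
Proof. by rewrite /refl cpair_wact wactB wactZ. Qed.

(** The reflection changes only the coefficient at [i], so a sign change forces all other
    coefficients of [a] to vanish; reducedness then leaves [alpha i]. *)
Lemma refl_pos_root i a : a \in Phi -> cone a ->
  cone (- refl (alpha i) a) -> a = alpha i.
Proof.
move=> aP [k aE] [k'].
rewrite /refl opprB; move: (cpair _ _) => c.
rewrite {1}aE {1}(comb_delta i) combZ combB => /comb_inj E.
have k0 j : j != i -> k j = 0%N.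
  move=> ji; move/eqP: (E j); rewrite (negbTE ji) mulr0 sub0r.
  rewrite eqr_oppLR -subr_eq0 opprK -natrD pnatr_eq0 addn_eq0.
  by case/andP=> /eqP.
have {}aE : a = (k i)%:R *: alpha i.
  rewrite [LHS]aE /comb (bigD1 i) //= big1 ?addr0 // => j /k0->.
  by rewrite scale0r.
have [k1|k1] : (k i)%:R = 1 :> R \/ (k i)%:R = - 1 :> R.
- by apply: (redPhi (alpha_root i)); rewrite -aE.
- by rewrite aE k1 scale1r.
- by have := ler0n R (k i); rewrite k1 oppr_ge0 ler10.
Qed.

(** Applying the letters of [t] one after another to [alpha i], some letter [j] turns a positive
    root negative. That root must be [alpha j], so the letter [j] cancels against the final [i]. *)
Lemma exchange t i : cone (- wact t (alpha i)) ->
  exists t', (size t' < size t)%N /\ same_elt alpha t' (rcons t i).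
Proof.
elim: t => [|j t IH] /= neg.
  by case: (@alpha_neq0 i); apply: cone_anti neg; apply: cone_alpha.
have [pos|/IH[t' [lt same]]] :=
    root_coneVN (wact_root t (alpha_root i)); last first.
  by exists (j :: t'); split=> // v /=; rewrite same.
exists t; split=> // v.
have /refl_pos_root/(_ pos neg) E := wact_root t (alpha_root i).
by rewrite /= wact_rcons wact_refl E reflK.
Qed.

(** * Integral and dominant weights *)

Lemma dominant_weight v : dominant v -> is_weight v. Proof. by case. Qed.

Lemma weightD u v : is_weight u -> is_weight v -> is_weight (u + v).
Proof.
move=> uw vw a aP; have [z zE] := uw a aP; have [z' zE'] := vw a aP.
by exists (z + z'); rewrite cpairDl zE zE' rmorphD.
Qed.

Lemma weightN v : is_weight v -> is_weight (- v).
Proof.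
by move=> vw a /vw[z zE]; exists (- z); rewrite cpairNl zE rmorphN.
Qed.

Lemma weight_wact s v : is_weight v -> is_weight (wact s v).
Proof.
by move=> vw a aP; rewrite -(wactVK s a) cpair_wact; apply/vw/wact_root.
Qed.

Lemma weight_cone v : cone v -> is_weight v.
Proof.
move=> [k ->]; rewrite /comb; elim/big_rec: _ => [a _|i u _ uw].
  by exists 0; rewrite -(scale0r (0 : V)) cpairZl mul0r.
apply: weightD uw => a aP; have [z zE] := cpair_int aP (alpha_root i).
by exists ((k i)%:Z * z); rewrite cpairZl zE rmorphM.
Qed.

Lemma weight_le lam v : is_weight lam -> cone (lam - v) -> is_weight v.
Proof.
by move=> lw /weight_cone/weightN/(weightD lw); rewrite opprB addrC subrK.
Qed.

Lemma dominantD u v : dominant u -> dominant v -> dominant (u + v).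
Proof.
move=> [uw u0] [vw v0]; split; first exact: weightD.
by move=> i; rewrite cpairDl addr_ge0.
Qed.

Lemma dominant_dot v i : dominant v -> 0 <= dot v (alpha i).
Proof. by case=> _ /(_ i); rewrite cpair_ge0. Qed.

Lemma dominant_cone v a : dominant v -> cone a -> 0 <= dot v a.
Proof.
move=> vd [k ->]; rewrite dotC dot_comb sumr_ge0 // => i _.
by rewrite mulr_ge0 // dotC dominant_dot.
Qed.

Lemma weight_cpair v i : is_weight v ->
  (exists m : nat, cpair v (alpha i) = m%:R) \/
  (exists m : nat, cpair v (alpha i) = - m.+1%:R).
Proof.
move=> /(_ _ (alpha_root i)) [[m|m] ->]; [left|right]; exists m => //.
Qed.

Lemma not_dominant v : is_weight v -> ~ dominant v ->
  exists i, cpair v (alpha i) <= -1.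
Proof.
move=> vw nd; apply: contrapT => /forallNP no; apply: nd; split=> // i.
have [[m ->]|[m mE]] := weight_cpair i vw; first exact: ler0n.
by case: (no i); rewrite mE lerN2 ler1n.
Qed.

Lemma cpair_alpha_ge1 v i : is_weight v -> 0 < cpair v (alpha i) ->
  1 <= cpair v (alpha i).
Proof.
move=> vw; have [[m ->]|[m ->]] := weight_cpair i vw.
  by rewrite ltr0n ler1n.
by rewrite oppr_gt0 ltrn0.
Qed.

(** Induction on length. If [wact s lam] pairs nonnegatively with [alpha i], the new letter
    subtracts a multiple of [alpha i]. Otherwise the inverse of [s] makes [alpha i] negative, and
    [exchange] yields a word shorter than [s]. *)
Lemma wact_le_dominant lam s : dominant lam -> cone (lam - wact s lam).
Proof.
move=> lamd; have [m] := ubnP (size s); elim: m s => // m IH [|i s] /= lt.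
  by rewrite subrr; apply: cone0.
have IHs : cone (lam - wact s lam) by apply: IH; lia.
have ws : is_weight (wact s lam) by apply/weight_wact/dominant_weight.
have [[q qE]|[q qE]] := weight_cpair i ws.
  rewrite /refl qE opprB addrCA addrC; apply: coneD => //.
  exact/coneZ/cone_alpha.
have [pos|neg] := root_coneVN (wact_root (rev s) (alpha_root i)).
  have := dominant_cone lamd pos; rewrite -(dot_wact s) wactVK -cpair_ge0 //.
  by rewrite qE oppr_ge0 lern0.
have [t [ltt same]] := exchange neg.
have -> : refl (alpha i) (wact s lam) = wact (rev t) lam.
  by rewrite -[LHS](wactK t) same wact_rcons reflK // wactK.
by apply: IH; move: ltt; rewrite !size_rev; lia.
Qed.

Lemma dominant_unique lam s :
  dominant lam -> dominant (wact s lam) -> wact s lam = lam.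
Proof.
move=> ld wd; apply/eqP; rewrite eq_sym -subr_eq0; apply/eqP.
apply: cone_anti; first exact: wact_le_dominant.
by rewrite opprB; have := wact_le_dominant (rev s) wd; rewrite wactK.
Qed.

(** * Finiteness of the Weyl group and longest words *)

Lemma same_elt_alpha s t :
  (forall i, wact s (alpha i) = wact t (alpha i)) -> same_elt alpha s t.
Proof.
move=> E v; apply/eqP; rewrite -subr_eq0; apply/eqP.
have -> : wact s v - wact t v = wact s (v - wact (rev s ++ t) v).
  by rewrite wactB wact_cat wactVK.
(* The word [rev s ++ t] preserves [dot] and fixes every simple root, so it moves [v] by a vector
   orthogonal to all simple roots. *)
suff -> : v - wact (rev s ++ t) v = 0 by rewrite -(scale0r (0 : V)) wactZ !scale0r.
apply: dot_alpha_eq0 => i; rewrite dotBl.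
have {2}-> : alpha i = wact (rev s ++ t) (alpha i) by rewrite wact_cat -E wactK.
by rewrite dot_wact subrr.
Qed.

Definition min_word s := forall t, same_elt alpha t s -> (size s <= size t)%N.

Lemma ex_min_word s : exists t, same_elt alpha t s /\ min_word t.
Proof.
have [m] := ubnP (size s); elim: m s => // m IH s lt.
have [ms|/existsNP[t /not_implyP[ts /negP]]] := pselect (min_word s).
  by exists s.
rewrite -ltnNge => lts; have [|u [ut mu]] := IH t; first by lia.
by exists u; split=> // v; rewrite ut.
Qed.

(** An element of the group is determined by the positions in [Phi] of the images of the simple
    roots. There are finitely many such codes, and minimal words sharing a code have equal
    length. *)
Lemma min_word_bounded : exists B, forall s, min_word s -> (size s <= B)%N.
Proof.
pose code s : {ffun 'I_l -> 'I_(size Phi)} :=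
  [ffun i => Ordinal (etrans (index_mem (wact s (alpha i)) Phi)
                             (wact_root s (alpha_root i)))].
have codeP s t : code s = code t -> same_elt alpha s t.
  move=> E; apply: same_elt_alpha => i.
  have /(congr1 val) := congr1 (fun f : {ffun _ -> _} => f i) E.
  rewrite !ffunE /= => /(congr1 (nth 0 Phi)).
  by rewrite !nth_index //; apply: wact_root.
have /choice[b bP] (f : {ffun 'I_l -> 'I_(size Phi)}) :
    exists m, forall s, min_word s -> code s = f -> (size s <= m)%N.
  have [[t tf]|no] := pselect (exists t, code t = f).
    exists (size t) => s ms sf; apply: ms; apply: codeP.
    by rewrite tf sf.
  by exists 0%N => s _ sf; case: no; exists s.
exists (\max_f b f)%N => s ms.
exact: leq_trans (bP _ _ ms erefl) (leq_bigmax (F := b) (code s)).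
Qed.

Lemma ex_longest_word : exists s, longest_word alpha s.
Proof.
have [B bound] := min_word_bounded.
pose P m := `[< exists s, min_word s /\ size s = m >].
have exP : exists m, P m.
  have [t [_ mt]] := ex_min_word [::].
  by exists (size t); apply/asboolP; exists t.
have leB m : P m -> (m <= B)%N by move=> /asboolP[s [/bound + <-]].
have [m /asboolP[s [ms <-]] maxm] := ex_maxnP exP leB.
exists s; split=> // t; have [t' [same mt']] := ex_min_word t.
by exists t'; split=> //; apply: maxm; apply/asboolP; exists t'.
Qed.

(** If [s] kept [alpha i] positive, a word [t] for [rcons s i], no longer than [s], would make it
    negative. Then [exchange] would give a word for [s] shorter than [t], against minimality of
    [s]. *)
Lemma longest_alpha s i : longest_word alpha s -> cone (- wact s (alpha i)).
Proof.
move=> [ms maxs].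
have [pos|//] := root_coneVN (wact_root s (alpha_root i)).
have [t [same le]] := maxs (rcons s i).
have [|t' [lt same']] := @exchange t i.
  by rewrite same wact_rcons refl_self // wactN opprK.
suff /ms : same_elt alpha t' s by rewrite leqNgt (leq_trans lt le).
by move=> v; rewrite same' wact_rcons same wact_rcons reflK.
Qed.

Lemma dominant_longest s lam : longest_word alpha s -> dominant lam ->
  dominant (- wact s lam).
Proof.
move=> ls ld; split=> [|i]; first exact/weightN/weight_wact/dominant_weight.
rewrite cpair_ge0 // dotNl -(wactVK s (alpha i)) dot_wact -dotNr.
have [[k kE]|] := root_coneVN (wact_root (rev s) (alpha_root i)); last first.
  exact: dominant_cone.
(* If the inverse of [s] kept [alpha i] positive, applying [s] to that positive combination would
   put [- alpha i] in the cone. *)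
suff : cone (- alpha i).
  by move/(cone_anti (cone_alpha i)) => /alpha_neq0.
rewrite -(wactVK s (alpha i)) kE wact_comb -sumrN.
elim/big_rec: _ => [|j v _ vc]; first exact: cone0.
by apply: coneD vc; rewrite -scalerN; apply/coneZ/longest_alpha.
Qed.

(** * Saturated sets of weights *)

(** For dominant [lam] these are the weights of the irreducible representation of highest weight
    [lam], described by the order and the Weyl group alone. *)
Definition saturation lam v := forall s, cone (lam - wact s v).

Lemma saturation_le lam v : saturation lam v -> cone (lam - v).
Proof. exact: (fun H => H [::]). Qed.

Lemma saturation_wact lam s v : saturation lam v -> saturation lam (wact s v).
Proof. by move=> vs t; rewrite -wact_cat. Qed.

Lemma saturation_weight lam v :
  dominant lam -> saturation lam v -> is_weight v.
Proof. by move=> [lw _] /saturation_le; apply: weight_le. Qed.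

Lemma saturation_dominant lam : dominant lam -> saturation lam lam.
Proof. by move=> ld s; apply: wact_le_dominant. Qed.

(** If [s] makes [alpha i] negative, compare with the conjugate of [v] under [rcons s i]: it differs
    from [wact s v] by [q.+1] copies of the root, and adding back [q] of them leaves the single one
    required. *)
Lemma saturationB lam v i : dominant lam -> saturation lam v ->
  1 <= cpair v (alpha i) -> saturation lam (v - alpha i).
Proof.
move=> ld vs v1 s; rewrite wactB opprB.
have [pos|neg] := root_coneVN (wact_root s (alpha_root i)).
  by rewrite addrCA addrC; apply: coneD.
have [[[|q] qE]|[q qE]] := weight_cpair i (saturation_weight ld vs).
- by move: v1; rewrite qE ler10.
- have := vs (rcons s i); rewrite wact_rcons /refl qE wactB wactZ => /coneD.
  move=> /(_ _ (coneZ q neg)); congr cone.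
  by rewrite -natr1; apply/rowP => j; rewrite !mxE; ring.
- by have := ler0n R q.+1; move: v1; rewrite qE; lra.
Qed.

Lemma saturationD lam v i : dominant lam -> saturation lam v ->
  cpair v (alpha i) <= -1 -> saturation lam (v + alpha i).
Proof.
move=> ld vs v1.
have -> : v + alpha i = wact [:: i] (wact [:: i] v - alpha i).
  by rewrite wactB /= reflK // refl_self // opprK.
apply/saturation_wact/saturationB => //; first exact: saturation_wact.
by rewrite /= /refl cpairBl cpairZl cpair_self //; lra.
Qed.

(** Height as a relation, the measure of the inductions that follow. *)
Definition cone_ht m v :=
  exists k : 'I_l -> nat, v = comb (fun i => (k i)%:R) /\ m = (\sum_i k i)%N.

Lemma cone_htP v : cone v -> exists m, cone_ht m v.
Proof. by move=> [k ->]; exists (\sum_i k i)%N, k. Qed.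

Lemma cone_htB m u v : cone_ht m v -> cone u -> u <> 0 -> cone (v - u) ->
  exists m', (m' < m)%N /\ cone_ht m' (v - u).
Proof.
move=> [k [vE ->]] [d uE] u0 [k' E]; exists (\sum_i k' i)%N; split; last first.
  by exists k'.
have kE i : k i = (k' i + d i)%N.
  apply/eqP; rewrite -(eqr_nat R) natrD; apply/eqP; move: i; apply: comb_inj.
  by rewrite -combD -E -uE -vE subrK.
rewrite (eq_bigr _ (fun i _ => kE i)) big_split /= -[X in (X < _)%N]addn0.
rewrite ltn_add2l lt0n sum_nat_eq0; apply/negP => /forallP d0; apply: u0.
by rewrite uE /comb big1 // => i _; rewrite (eqP (d0 i)) scale0r.
Qed.

(** Reflecting in a simple root that pairs negatively with [v] raises [v] inside the saturated set,
    so the height of [lam - v] drops until [v] is dominant. *)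
Lemma saturation_conj lam v : dominant lam -> saturation lam v ->
  exists s, dominant (wact s v) /\ cone (wact s v - v).
Proof.
move=> ld vs; have [m] := cone_htP (saturation_le vs).
elim/ltn_ind: m v vs => m IH v vs hm.
have vw := saturation_weight ld vs.
have [vd|/(not_dominant vw)[i vi]] := pselect (dominant v).
  by exists [::]; rewrite subrr; split=> //; apply: cone0.
have [[q qE]|[q qE]] := weight_cpair i vw.
  by have := ler0n R q; move: vi; rewrite qE; lra.
have rE : refl (alpha i) v = v + q.+1%:R *: alpha i.
  by rewrite /refl qE scaleNr opprK.
have c : cone (q.+1%:R *: alpha i) by apply/coneZ/cone_alpha.
have rs := saturation_wact [:: i] vs.
have [||m' [lt hm']] := cone_htB hm c.
- by move/eqP; rewrite scaler_eq0 pnatr_eq0 /= => /eqP/alpha_neq0.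
- by rewrite -addrA -opprD -rE; exact: (saturation_le rs).
have rht : cone_ht m' (lam - wact [:: i] v) by rewrite /= rE opprD addrA.
have [s [sd sc]] := IH _ lt _ rs rht.
exists (rcons s i); rewrite wact_rcons; split=> //.
by have := coneD sc c; rewrite /= {2}rE opprD addrA subrK.
Qed.

(** * Decompositions of [nu] and the first clause of a low triple *)

Section LowTriple.
Variables lam mu nu : V.
Hypothesis lamd : dominant lam.
Hypothesis mud : dominant mu.
Hypothesis nud : dominant nu.

(** Start from [lam + mu] and descend. While the sum differs from [nu], a simple root in the support
    of the difference pairs positively with it. As [nu] is dominant, [x] or [y] pairs positively
    with that root and can lose it. *)
Lemma saturation_split : cone (lam + mu - nu) ->
  exists x y, [/\ saturation lam x, saturation mu y & x + y = nu].
Proof.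
move=> /cone_htP[m hm].
suff : forall x y, saturation lam x -> saturation mu y -> cone_ht m (x + y - nu) ->
    exists x y, [/\ saturation lam x, saturation mu y & x + y = nu].
  by apply; [apply: saturation_dominant..|].
elim/ltn_ind: m {hm} => m IH x y xs ys hm.
have [|/eqP ne] := boolP (x + y - nu == 0).
  by rewrite subr_eq0 => /eqP; exists x, y.
have [k [kE _]] := hm.
have [i [ki]] := comb_pos_dot (k := k) (fun e => ne (etrans kE e)).
rewrite -kE -cpair_gt0 // cpairBl cpairDl => pos.
have nui := nud.2 i.
have c : cone (x + y - nu - alpha i).
  exists (fun j => k j - (j == i))%N; rewrite kE (comb_delta i) combB.
  by apply: eq_comb => j; rewrite natrB //; case: eqP => // ->.
have [m' [lt hm']] := cone_htB hm (cone_alpha i) (@alpha_neq0 i) c.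
have [xi|xi] := ltP 0 (cpair x (alpha i)).
  apply: (IH _ lt (x - alpha i) y) => //; last first.
    by rewrite (addrAC x) (addrAC (x + y)).
  by apply/saturationB/cpair_alpha_ge1 => //; apply: saturation_weight xs.
apply: (IH _ lt x (y - alpha i)) => //; last by rewrite addrA (addrAC (x + y)).
apply/saturationB/cpair_alpha_ge1 => //; last by lra.
exact: saturation_weight ys.
Qed.

Hypothesis low : forall lam' mu', dominant lam' -> dominant mu' ->
  dom_le alpha lam' lam -> dom_le alpha mu' mu -> dom_le alpha nu (lam' + mu') ->
  lam' = lam /\ mu' = mu.

(** The dominant conjugates of [x] and [y] lie above [x] and [y], so their sum is still at least
    [nu], and [low] identifies them with [lam] and [mu]. *)
Lemma low_orbit x y : saturation lam x -> saturation mu y -> x + y = nu ->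
  (exists s, wact s x = lam) /\ (exists t, wact t y = mu).
Proof.
move=> xs ys xy; have [s [sd sc]] := saturation_conj lamd xs.
have [t [td tc]] := saturation_conj mud ys.
have [||| <- <-] := low sd td; first exact: xs; first exact: ys.
  rewrite -xy; have := coneD sc tc; congr cone.
  by apply/rowP=> j; rewrite !mxE; ring.
by split; [exists s|exists t].
Qed.

(** While [x] is not dominant, some simple root pairs to at most -1 with [x], hence to at least 1
    with [y] because [nu] is dominant. Moving it from [y] to [x] keeps both saturated. The final
    dominant [x] is conjugate to [lam], hence equal to it. *)
Lemma saturation_low : cone (lam + mu - nu) -> saturation mu (nu - lam).
Proof.
move=> /saturation_split[x [y [xs ys xy]]].
have [m hm] := cone_htP (saturation_le xs).
elim/ltn_ind: m x y xs ys xy hm => m IH x y xs ys xy hm.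
have xw := saturation_weight lamd xs.
have [xd|/(not_dominant xw)[i xi]] := pselect (dominant x).
  have [[s sx] _] := low_orbit xs ys xy.
  have -> : lam = x by rewrite -sx; apply: dominant_unique => //; rewrite sx.
  by rewrite -xy addrC addKr.
have xs' := saturationD lamd xs xi.
have yi : 1 <= cpair y (alpha i).
  by have := nud.2 i; rewrite -xy cpairDl; lra.
have c := saturation_le xs'.
rewrite opprD addrA in c.
have [m' [lt hm']] := cone_htB hm (cone_alpha i) (@alpha_neq0 i) c.
apply: (IH _ lt _ _ xs' (saturationB mud ys yi)); last by rewrite opprD addrA.
by rewrite addrACA subrr addr0.
Qed.

(* Moving a simple root from [x] to [y] keeps both inside their orbits, so norms
   force [<x, alpha i> = 1 = - <y, alpha i>]; hence only simple roots orthogonal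
   to [nu] are ever moved. *)
Lemma low_supported : cone (lam + mu - nu) ->
  supported [pred i | cpair nu (alpha i) == 0] (lam + mu - nu).
Proof.
move=> /saturation_low; set Z := [pred i | _].
suff IH m x y : saturation lam x -> saturation mu y -> x + y = nu ->
    supported Z (lam - x) -> cone_ht m (mu - y) -> supported Z (lam + mu - nu).
  move=> ys; have [m] := cone_htP (saturation_le ys).
  apply: IH (saturation_dominant lamd) ys _ _; first by rewrite addrC subrK.
  rewrite subrr; exists (fun=> 0); split=> //.
  by rewrite /comb big1 // => i _; rewrite scale0r.
elim/ltn_ind: m x y => m IH x y xs ys xy xZ hm.
have [[s sx] [t ty]] := low_orbit xs ys xy.
have yw := saturation_weight mud ys.
have [yd|/(not_dominant yw)[i yi]] := pselect (dominant y).
  have -> : mu = y by rewrite -ty; apply: dominant_unique => //; rewrite ty.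
  by rewrite -xy opprD addrACA subrr addr0.
have ys' := saturationD mud ys yi.
have xi : 1 <= cpair x (alpha i).
  by have := nud.2 i; rewrite -xy cpairDl; lra.
have xs' := saturationB lamd xs xi.
have xy' : x - alpha i + (y + alpha i) = nu by rewrite addrACA addNr addr0.
have [[s' sx'] [t' ty']] := low_orbit xs' ys' xy'.
have x1 : cpair x (alpha i) = 1.
  by apply: cpair_eq1 => //; rewrite -(dot_wact s') sx' -sx dot_wact.
have y1 : cpair y (alpha i) = -1.
  apply/eqP; rewrite -eqr_oppLR -cpairNl; apply/eqP/cpair_eq1 => //.
  by rewrite -opprD !(dotNl, dotNr) !opprK -(dot_wact t') ty' -ty dot_wact.
have Zi : Z i by rewrite /= -xy cpairDl x1 y1 subrr.
have c := saturation_le ys'; rewrite opprD addrA in c.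
have [m' [lt hm']] := cone_htB hm (cone_alpha i) (@alpha_neq0 i) c.
apply: (IH _ lt _ _ xs' ys' xy'); last by rewrite opprD addrA.
by rewrite opprB addrCA addrC; apply: supportedD xZ (supported_alpha Zi).
Qed.

End LowTriple.

End RootSystem.

(** * Both directions of the classification *)

Theorem theoremB (R : realType) (n l : nat) (Phi : seq 'rV[R]_n)
    (alpha : 'I_l -> 'rV[R]_n) (lam mu nu : 'rV[R]_n) :
  root_system Phi -> reduced Phi -> irreducible Phi -> is_base Phi alpha ->
  dominant Phi alpha lam -> dominant Phi alpha mu -> dominant Phi alpha nu ->
  (low_triple Phi alpha lam mu nu <->
   [/\ minuscule Phi alpha lam, minuscule Phi alpha mu,
       (exists w0 : seq 'I_l, longest_word alpha w0 /\ mu = - wact alpha w0 lam)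
     & nu = 0]).
Proof.
move=> rPhi redPhi irr bPhi lamd mud nud.
have nz i : alpha i <> 0 := @alpha_neq0 _ _ _ _ _ rPhi bPhi i.
(* Without simple roots every root would be an empty sum, hence zero. *)
have [i0] : inhabited 'I_l.
  have [a aP] : exists a, a \in Phi.
    by case: irr => + _; case: (Phi) => // a s _; exists a; apply: mem_head.
  apply: contrapT => no; apply: (root_neq0 rPhi aP).
  have [_ _ /(_ _ aP)[k [-> _]]] := bPhi.
  by rewrite big1 // => i; case: no.
split=> [[low [k kE]]|[[lam0 _ lmin] [_ _ mmin] [w [lw muE]] ->]]; last first.
  split=> [lam' mu' ld md ll lm _|]; first by split; [apply: lmin|apply: mmin].
  have [c cE] : cone alpha (lam + mu).
    by rewrite muE; apply: (wact_le_dominant rPhi redPhi bPhi).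
  have sum0 : lam + mu <> 0.
    move=> E; apply: lam0; apply: (dot_alpha_eq0 rPhi bPhi) => i.
    have := dominant_dot rPhi bPhi i lamd.
    have := dominant_dot rPhi bPhi i mud.
    have -> : mu = - lam by apply/eqP; rewrite -addr_eq0 addrC E.
    by rewrite dotNl; lra.
  have sumd := dominantD lamd mud.
  (* Full support makes every [c i] at least 1, so removing one copy of each simple root loses
     nothing to truncation. *)
  exists (fun i => (c i).-1); rewrite add0r cE /comb -sumrB.
  apply: eq_bigr => i _; rewrite -{2}[alpha i]scale1r -scalerBl.
  have ci : (0 < c i)%N.
    rewrite -(ltr0n R); apply: (comb_gt0 rPhi bPhi irr (c := fun i => (c i)%:R)).
      by rewrite -cE.
    by move=> j; rewrite -cE; apply: (dominant_dot rPhi bPhi).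
  by rewrite -[in LHS](prednK ci) -natr1 addrK.
have sumE : lam + mu - nu = comb alpha (fun i => (k i).+1%:R).
  move/eqP: kE; rewrite opprD addrA subr_eq -big_split /= => /eqP->.
  by apply: eq_bigr => i _; rewrite -natr1 scalerDl scale1r.
have sumc : cone alpha (lam + mu - nu) by exists (fun i => (k i).+1).
(* All coefficients [(k i).+1] are nonzero, whereas [low_supported] confines the support to simple
   roots orthogonal to [nu]; so [nu] is orthogonal to all of them. *)
have nu0 : nu = 0.
  have [c [cE c0]] := low_supported rPhi redPhi bPhi lamd mud nud low sumc.
  apply: (dot_alpha_eq0 rPhi bPhi) => i; apply: cpair_eq0 => //.
  apply/eqP; rewrite -[_ == 0]negbK; apply/negP => /c0/eqP.
  rewrite cE in sumE; rewrite (comb_inj bPhi sumE).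
  by rewrite pnatr_eq0.
subst nu; rewrite subr0 in sumE.
(* For [nu = 0], replacing [lam] or [mu] by a smaller dominant weight keeps the sum dominant and in
   the root lattice, hence at least 0. The last premise of [low] is then automatic. *)
have lattice u v d : dominant Phi alpha u -> dominant Phi alpha v ->
    u + v = comb alpha (fun i => (k i).+1%:R - (d i)%:R) -> dom_le alpha 0 (u + v).
  move=> ud vd uvE; rewrite /dom_le subr0 uvE.
  have ge i : (d i <= (k i).+1)%N.
    rewrite -(ler_nat R) -subr_ge0; move: i; apply: (comb_ge0 rPhi bPhi) => i.
    by rewrite -uvE; apply/(dominant_dot rPhi bPhi)/dominantD.
  exists (fun i => (k i).+1 - d i)%N; apply: eq_comb => i.
  by rewrite natrB.
have le_refl v : dom_le alpha v v by rewrite /dom_le subrr; apply: cone0.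
have min_lam v : dominant Phi alpha v -> dom_le alpha v lam -> v = lam.
  move=> vd vl; have [d dE] := vl.
  have [|] := low v mu vd mud vl (le_refl _) => //.
  apply: (lattice _ _ d) => //; rewrite -combB -sumE -[comb _ _]dE.
  by apply/rowP=> j; rewrite !mxE; ring.
have min_mu v : dominant Phi alpha v -> dom_le alpha v mu -> v = mu.
  move=> vd vl; have [d dE] := vl.
  have [|] := low lam v lamd vd (le_refl _) vl => //.
  apply: (lattice _ _ d) => //; rewrite -combB -sumE -[comb _ _]dE.
  by apply/rowP=> j; rewrite !mxE; ring.
have [w lw] := ex_longest_word rPhi bPhi.
have wd := dominant_longest rPhi redPhi bPhi lw lamd.
(* The decomposition [lam + (- lam) = 0] puts [- lam] in the orbit of [mu]; the dominant weight
   [- wact w lam] lies in that orbit too, so it is [mu]. *)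
have muE : mu = - wact alpha w lam.
  have ys := saturation_low rPhi redPhi bPhi lamd mud nud low sumc.
  have [] := low_orbit rPhi bPhi lamd mud low
    (saturation_dominant rPhi redPhi bPhi lamd) ys; first by rewrite addrC subrK.
  move=> _ [t]; rewrite sub0r => tE.
  apply: esym; rewrite -wactN -(wactK rPhi bPhi t (- lam)) tE -wact_cat.
  apply: (dominant_unique rPhi redPhi bPhi) => //.
  by rewrite wact_cat -tE (wactK rPhi bPhi) wactN.
have mu_lam0 : lam + mu <> 0.
  move=> E; move: sumE; rewrite E => /esym E0.
  have : comb alpha (fun i => (k i).+1%:R) = comb alpha (fun=> 0).
    by rewrite E0 /comb big1 // => j _; rewrite scale0r.
  by move/(comb_inj bPhi)/(_ i0)/eqP; rewrite pnatr_eq0.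
split=> //.
- split=> // l0; apply: mu_lam0; rewrite muE l0.
  by rewrite -(scale0r (0 : 'rV[R]_n)) wactZ !scale0r oppr0 addr0.
- split=> // m0; apply: mu_lam0; move/eqP: muE.
  rewrite m0 eq_sym oppr_eq0 => /eqP/(congr1 (wact alpha (rev w))).
  rewrite (wactK rPhi bPhi) => ->.
  by rewrite -(scale0r (0 : 'rV[R]_n)) wactZ !scale0r addr0.
- by exists w.
Qed.
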